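(* Let $\mathcal C$ be a strict bimonoidal intermuting category. Then $\mathcal C$ determines a lax functor $\mathcal C_{**}:\Delta^{op}\times\Delta^{op}\to \mathit{Cat}$ such that $\mathcal C_{p_1,p_2}=\mathcal C^{p_1p_2}$ for all objects $(p_1,p_2)$ of $\Delta^{op}\times\Delta^{op}$; namely, the functors assigned to arrows are the functors $\mathcal C_{\alpha,\beta}=\gamma^*$ described in the context, and the structural natural transformations have canonical arrows of $\mathcal C$ as components.
   Context: Bimonoidal intermuting categories. Let $\xi\in\{\wedge,\vee\}$; hats mark the natural transformations attached to $\wedge$ and checks those attached to $\vee$. A bimonoidal intermuting category is $\langle\mathcal A,\wedge,\vee,\top,\bot\rangle$ where $\wedge,\vee:\mathcal A\times\mathcal A\to\mathcal A$ are functors, $\top,\bot$ are objects, and there are: (1) natural isomorphisms $\hat b^{\to}_{A,B,C}:A\wedge(B\wedge C)\to(A\wedge B)\wedge C$, $\check b^{\to}_{A,B,C}:A\vee(B\vee C)\to(A\vee B)\vee C$, with inverses $\hat b^{\leftarrow}_{A,B,C},\check b^{\leftarrow}_{A,B,C}$, each satisfying $b^{\to}_{A\xi B,C,D}\circ b^{\to}_{A,B,C\xi D}=(b^{\to}_{A,B,C}\,\xi\,\mathbf 1_D)\circ b^{\to}_{A,B\xi C,D}\circ(\mathbf 1_A\,\xi\, b^{\to}_{B,C,D})$; (2) natural isomorphisms $\hat\delta^{\to}_A:A\wedge\top\to A$, $\hat\sigma^{\to}_A:\top\wedge A\to A$, $\check\delta^{\to}_A:A\vee\bot\to A$, $\check\sigma^{\to}_A:\bot\vee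 A\to A$, with inverses $\hat\delta^{\leftarrow},\hat\sigma^{\leftarrow},\check\delta^{\leftarrow},\check\sigma^{\leftarrow}$, with $\hat\delta^{\to}_\top=\hat\sigma^{\to}_\top$, $\check\delta^{\to}_\bot=\check\sigma^{\to}_\bot$, $\hat b^{\to}_{A,\top,C}=\hat\delta^{\leftarrow}_A\wedge\hat\sigma^{\to}_C$, $\check b^{\to}_{A,\bot,C}=\check\delta^{\leftarrow}_A\vee\check\sigma^{\to}_C$; (3) isomorphisms $\hat w^{\leftarrow}_\bot:\bot\to\bot\wedge\bot$ and $\check w^{\to}_\top:\top\vee\top\to\top$ with inverses $\hat w^{\to}_\bot$, $\check w^{\leftarrow}_\top$, satisfying $\check w^{\to}_\top\circ(\check w^{\to}_\top\vee\mathbf 1_\top)\circ\check b^{\to}_{\top,\top,\top}=\check w^{\to}_\top\circ(\mathbf 1_\top\vee\check w^{\to}_\top)$ and $\hat b^{\leftarrow}_{\bot,\bot,\bot}\circ(\hat w^{\leftarrow}_\bot\wedge\mathbf 1_\bot)\circ\hat w^{\leftarrow}_\bot=(\mathbf 1_\bot\wedge\hat w^{\leftarrow}_\bot)\circ\hat w^{\leftarrow}_\bot$; (4) an arrow $\kappa:\bot\to\top$ with $\check\delta^{\to}_\top=\check w^{\to}_\top\circ(\mathbf 1_\top\vee\kappa)$, $\check\sigma^{\to}_\top=\check w^{\to}_\top\circ(\kappa\vee\mathbf 1_\top)$, $\hat\delta^{\leftarrow}_\bot=(\mathbf 1_\bot\wedge\kappa)\circ\hat w^{\leftarrow}_\bot$,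 $\hat\sigma^{\leftarrow}_\bot=(\kappa\wedge\mathbf 1_\bot)\circ\hat w^{\leftarrow}_\bot$; (5) a natural transformation $c^k_{A,B,C,D}:(A\wedge B)\vee(C\wedge D)\to(A\vee C)\wedge(B\vee D)$ satisfying $$c^k_{A_1\vee A_2,A_1'\vee A_2',A_3,A_3'}\circ(c^k_{A_1,A_1',A_2,A_2'}\vee\mathbf 1_{A_3\wedge A_3'})\circ\check b^{\to}_{A_1\wedge A_1',A_2\wedge A_2',A_3\wedge A_3'}=(\check b^{\to}_{A_1,A_2,A_3}\wedge\check b^{\to}_{A_1',A_2',A_3'})\circ c^k_{A_1,A_1',A_2\vee A_3,A_2'\vee A_3'}\circ(\mathbf 1_{A_1\wedge A_1'}\vee c^k_{A_2,A_2',A_3,A_3'}),$$ $$\hat b^{\leftarrow}_{A_1\vee A_1',A_2\vee A_2',A_3\vee A_3'}\circ(c^k_{A_1,A_2,A_1',A_2'}\wedge\mathbf 1_{A_3\vee A_3'})\circ c^k_{A_1\wedge A_2,A_3,A_1'\wedge A_2',A_3'}=(\mathbf 1_{A_1\vee A_1'}\wedge c^k_{A_2,A_3,A_2',A_3'})\circ c^k_{A_1,A_2\wedge A_3,A_1',A_2'\wedge A_3'}\circ(\hat b^{\leftarrow}_{A_1,A_2,A_3}\vee\hat b^{\leftarrow}_{A_1',A_2',A_3'}),$$ $$\check\delta^{\to}_{A\wedge A'}=(\check\delta^{\to}_A\wedge\check\delta^{\to}_{A'})\circ c^k_{A,A',\bot,\bot}\circ(\mathbf 1_{A\wedge A'}\vee\hat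 w^{\leftarrow}_\bot),\quad \check\sigma^{\to}_{A\wedge A'}=(\check\sigma^{\to}_A\wedge\check\sigma^{\to}_{A'})\circ c^k_{\bot,\bot,A,A'}\circ(\hat w^{\leftarrow}_\bot\vee\mathbf 1_{A\wedge A'}),$$ $$\hat\delta^{\leftarrow}_{A\vee A'}=(\mathbf 1_{A\vee A'}\wedge\check w^{\to}_\top)\circ c^k_{A,\top,A',\top}\circ(\hat\delta^{\leftarrow}_A\vee\hat\delta^{\leftarrow}_{A'}),\quad \hat\sigma^{\leftarrow}_{A\vee A'}=(\check w^{\to}_\top\wedge\mathbf 1_{A\vee A'})\circ c^k_{\top,A,\top,A'}\circ(\hat\sigma^{\leftarrow}_A\vee\hat\sigma^{\leftarrow}_{A'}),$$ $$\hat\delta^{\to}_\top\circ(\check\delta^{\to}_\top\wedge\check\sigma^{\to}_\top)\circ c^k_{\top,\bot,\bot,\top}=\kappa\circ\check\delta^{\to}_\bot\circ(\hat\sigma^{\to}_\bot\vee\hat\delta^{\to}_\bot),\quad \hat\delta^{\to}_\top\circ(\check\sigma^{\to}_\top\wedge\check\delta^{\to}_\top)\circ c^k_{\bot,\top,\top,\bot}=\kappa\circ\check\delta^{\to}_\bot\circ(\hat\delta^{\to}_\bot\vee\hat\sigma^{\to}_\bot).$$ It is strict when all components of $\hat b^{\to},\hat b^{\leftarrow},\check b^{\to},\check b^{\leftarrow}$ and of $\hat\delta,\hat\sigma,\check\delta,\check\sigma$ (with either superscript) are identity arrows. (The arrows $\hat w_\bot,\check w_\top,\kappa$ need not be identities.)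 Canonical arrows of $\mathcal C$ are those built from identities, the structural arrows in (1)–(5) and the inverses stated there by composition and the operations $\wedge,\vee$. Simplicial data. $\Delta$ is the topologists' simplicial category: its objects are identified with $p=0,1,2,\ldots$ (standing for the ordered set $\{0,\ldots,p\}$) and its arrows are order-preserving maps. An arrow $\alpha:m\to m'$ of $\Delta^{op}$ is thus an order-preserving map $\{0,\ldots,m'\}\to\{0,\ldots,m\}$, also denoted $\alpha$. An object of $\mathcal C^{mn}$ is written $(A^s_t)_{1\le s\le m,1\le t\le n}$. For $\gamma=(\alpha,\beta)$ with $\alpha:m\to m'$, $\beta:n\to n'$ in $\Delta^{op}$, the functor $\gamma^*=\mathcal C_{\alpha,\beta}:\mathcal C^{mn}\to\mathcal C^{m'n'}$ is obtained by applying the bar (nerve) construction for $\vee,\bot$ in the first coordinate and then that for $\wedge,\top$ in the second: $$(\gamma^*(A))^i_j=\bigwedge_{\beta(j-1)<t\le\beta(j)}\ \bigvee_{\alpha(i-1)<s\le\alpha(i)}A^s_t\qquad(1\le i\le m',\ 1\le j\le n'),$$ in increasing order of indices, where an empty $\bigvee$ is $\bot$ and an empty $\bigwedge$ is $\top$; similarly on arrows. A lax functor $F$ from a category $\mathcal D$ to $\mathit{Cat}$ assigns a category to each object, a functor to each arrow, and natural transformations $F(g)\circ F(f)\Rightarrow F(g\circ f)$ for composable $f,g$ (here with $F$ of an identity arrow being the identity functor), satisfying the usual unit conditions and the associativity condition that the two resulting transformations $F(h)\circ F(g)\circ F(f)\Rightarrow F(h\circ g\circ f)$ coincide. *)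

(* Defs.v *)
From mathcomp Require Import all_boot all_order.
From Stdlib Require Import FunctionalExtensionality ProofIrrelevance.

Set Implicit Arguments.
Unset Strict Implicit.
Unset Printing Implicit Defensive.

Import Order.TTheory.

Declare Scope cat_scope.
Delimit Scope cat_scope with cat.
Local Open Scope cat_scope.

Reserved Notation "A ~> B" (at level 99, B at level 200, no associativity).
Reserved Notation "g ∘ f" (at level 40, left associativity).
Reserved Notation "A ∧ B" (at level 80, right associativity).
Reserved Notation "A ∨ B" (at level 85, right associativity).
Reserved Notation "f ∧₁ g" (at level 80, right associativity).
Reserved Notation "f ∨₁ g" (at level 85, right associativity).
Reserved Notation "f ≡ g" (at level 70, no associativity).

Record category := Category {
  ob :> Type;
  hom : ob -> ob -> Type;
  idc : forall A, hom A A;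
  comp : forall A B C, hom B C -> hom A B -> hom A C;
  comp_idl : forall A B (f : hom A B), comp (idc B) f = f;
  comp_idr : forall A B (f : hom A B), comp f (idc A) = f;
  comp_assoc : forall A B C D (h : hom C D) (g : hom B C) (f : hom A B),
    comp h (comp g f) = comp (comp h g) f }.

Arguments hom {c} A B.
Arguments idc {c} A.
Arguments comp {c A B C} g f.

Notation "A ~> B" := (hom A B) : cat_scope.
Notation "g ∘ f" := (comp g f) : cat_scope.

(* [f ≡ g] says that [f] and [g] are the same arrow, source and target
   included. It makes sense when the sources (or targets) are equal without
   being convertible, as happens in strict structures. *)
Record arrow (C : category) := Arrow { dom : C; cod : C; arr : dom ~> cod }.

Arguments Arrow {C dom cod} arr.

Notation "f ≡ g" := (Arrow f = Arrow g) : cat_scope.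

Definition is_identity (C : category) (A B : C) (f : A ~> B) : Prop :=
  f ≡ idc A.

Record functor (C D : category) := Functor {
  fob :> C -> D;
  fmap : forall A B : C, (A ~> B) -> (fob A ~> fob B);
  fmap_id : forall A : C, fmap (idc A) = idc (fob A);
  fmap_comp : forall (X Y Z : C) (g : Y ~> Z) (f : X ~> Y),
    fmap (g ∘ f) = fmap g ∘ fmap f }.

Arguments fmap {C D} _ {A B} _.

Definition id_functor (C : category) : functor C C :=
  @Functor C C id (fun _ _ f => f) (fun _ => erefl) (fun _ _ _ _ _ => erefl).

Definition comp_functor (C D E : category) (G : functor D E) (F : functor C D) :
  functor C E.
Proof.
refine (@Functor C E (fun A => G (F A)) (fun A B f => fmap G (fmap F f)) _ _).
- by move=> A; rewrite !fmap_id.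
- by move=> X Y Z g f; rewrite !fmap_comp.
Defined.

Record nat_trans (C D : category) (F G : functor C D) := NatTrans {
  component :> forall A : C, F A ~> G A;
  naturality : forall (A B : C) (f : A ~> B),
    component B ∘ fmap F f = fmap G f ∘ component A }.

Definition op_category (C : category) : category.
Proof.
refine (@Category C (fun A B => B ~> A) idc (fun X Y Z g f => f ∘ g) _ _ _).
- by move=> A B f; apply: comp_idr.
- by move=> A B f; apply: comp_idl.
- by move=> X Y Z T h g f; rewrite comp_assoc.
Defined.

Definition prod_category (C D : category) : category.
Proof.
refine (@Category (C * D)%type
  (fun A B => ((A.1 ~> B.1) * (A.2 ~> B.2))%type)
  (fun A => (idc A.1, idc A.2))
  (fun X Y Z g f => (g.1 ∘ f.1, g.2 ∘ f.2)) _ _ _).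
- by move=> A B [f1 f2] /=; rewrite !comp_idl.
- by move=> A B [f1 f2] /=; rewrite !comp_idr.
- by move=> X Y Z T [h1 h2] [g1 g2] [f1 f2] /=; rewrite !comp_assoc.
Defined.

Definition power_category (I : Type) (C : category) : category.
Proof.
refine (@Category (I -> C)
  (fun A B => forall i, A i ~> B i)
  (fun A i => idc (A i))
  (fun X Y Z g f i => g i ∘ f i) _ _ _).
- by move=> A B f; apply: functional_extensionality_dep => i; apply: comp_idl.
- by move=> A B f; apply: functional_extensionality_dep => i; apply: comp_idr.
- move=> X Y Z T h g f; apply: functional_extensionality_dep => i.
  exact: comp_assoc.
Defined.

(* The object p stands for the ordered set {0, ..., p}. *)

Definition simplex_hom (p q : nat) : Type := {omorphism 'I_p.+1 -> 'I_q.+1}.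

Definition simplex_id (p : nat) : simplex_hom p p := idfun.

Definition simplex_comp (p q r : nat) (g : simplex_hom q r)
  (f : simplex_hom p q) : simplex_hom p r := g \o f.

Lemma simplex_hom_ext (p q : nat) (f g : simplex_hom p q) :
  (f : 'I_p.+1 -> 'I_q.+1) =1 g -> f = g.
Proof.
case: f g => [f [[cf]]] [g [[cg]]] /= /functional_extensionality fg.
by case: _ / fg cg => cg; rewrite (proof_irrelevance _ cf cg).
Qed.

Definition simplex_category : category.
Proof.
refine (@Category nat simplex_hom simplex_id simplex_comp _ _ _).
all: by move=> *; apply: simplex_hom_ext.
Defined.

Notation Δ := simplex_category.

(* A lax functor to Cat with given action [F0] on objects and [F1] on arrows,
   in the case where F of an identity arrow is an identity functor, so that
   the unit transformations are identities. Source and target of the arrows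
   compared in the last three conditions are equal but not convertible. *)
Record lax_functor_on (D : category) (F0 : D -> category)
    (F1 : forall x y : D, (x ~> y) -> functor (F0 x) (F0 y)) := LaxFunctorOn {
  lax_id : forall x : D, F1 _ _ (idc x) = id_functor (F0 x);
  lax_comp : forall (x y z : D) (f : x ~> y) (g : y ~> z),
    nat_trans (comp_functor (F1 _ _ g) (F1 _ _ f)) (F1 _ _ (g ∘ f));
  lax_unitl : forall (x y : D) (f : x ~> y) (A : F0 x),
    lax_comp f (idc y) A ≡ idc (F1 _ _ f A);
  lax_unitr : forall (x y : D) (f : x ~> y) (A : F0 x),
    lax_comp (idc x) f A ≡ idc (F1 _ _ f A);
  lax_assoc : forall (x y z t : D) (f : x ~> y) (g : y ~> z) (h : z ~> t)
      (A : F0 x),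
    lax_comp (g ∘ f) h A ∘ fmap (F1 _ _ h) (lax_comp f g A)
    ≡ lax_comp f (h ∘ g) A ∘ lax_comp g h (F1 _ _ f A) }.

Definition bimap (C : category) (T : functor (prod_category C C) C)
    (A A' B B' : C) (f : A ~> A') (g : B ~> B') : T (A, B) ~> T (A', B') :=
  @fmap _ _ T (A, B) (A', B') (f, g).

(* The data and equations imposed on each of the two functors separately;
   [_to] and [_from] are the arrows with superscripts → and ←. *)
Record monoidal (C : category) := Monoidal {
  tens : functor (prod_category C C) C;
  unit_ob : C;
  b_to : forall X Y Z : C,
    tens (X, tens (Y, Z)) ~> tens (tens (X, Y), Z);
  b_from : forall X Y Z : C,
    tens (tens (X, Y), Z) ~> tens (X, tens (Y, Z));
  delta_to : forall X : C, tens (X, unit_ob) ~> X;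
  delta_from : forall X : C, X ~> tens (X, unit_ob);
  sigma_to : forall X : C, tens (unit_ob, X) ~> X;
  sigma_from : forall X : C, X ~> tens (unit_ob, X);
  b_nat : forall (X X' Y Y' Z Z' : C)
      (f : X ~> X') (g : Y ~> Y') (h : Z ~> Z'),
    b_to X' Y' Z' ∘ bimap tens f (bimap tens g h)
    = bimap tens (bimap tens f g) h ∘ b_to X Y Z;
  delta_nat : forall (X X' : C) (f : X ~> X'),
    delta_to X' ∘ bimap tens f (idc unit_ob) = f ∘ delta_to X;
  sigma_nat : forall (X X' : C) (f : X ~> X'),
    sigma_to X' ∘ bimap tens (idc unit_ob) f = f ∘ sigma_to X;
  b_toK : forall X Y Z, b_from X Y Z ∘ b_to X Y Z = idc _;
  b_fromK : forall X Y Z, b_to X Y Z ∘ b_from X Y Z = idc _;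
  delta_toK : forall X, delta_from X ∘ delta_to X = idc _;
  delta_fromK : forall X, delta_to X ∘ delta_from X = idc _;
  sigma_toK : forall X, sigma_from X ∘ sigma_to X = idc _;
  sigma_fromK : forall X, sigma_to X ∘ sigma_from X = idc _;
  pentagon : forall X Y Z T : C,
    b_to (tens (X, Y)) Z T ∘ b_to X Y (tens (Z, T))
    = bimap tens (b_to X Y Z) (idc T) ∘ b_to X (tens (Y, Z)) T
      ∘ bimap tens (idc X) (b_to Y Z T);
  delta_sigma_unit : delta_to unit_ob = sigma_to unit_ob;
  b_unit : forall X Z : C,
    b_to X unit_ob Z = bimap tens (delta_from X) (sigma_to Z) }.

Record bimonoidal_category := BimonoidalCategory {
  bim_cat :> category;
  meet_str : monoidal bim_cat;
  join_str : monoidal bim_cat }.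

Notation "A ∧ B" := (tens (meet_str _) (A, B)) : cat_scope.
Notation "A ∨ B" := (tens (join_str _) (A, B)) : cat_scope.
Notation "f ∧₁ g" := (bimap (tens (meet_str _)) f g) : cat_scope.
Notation "f ∨₁ g" := (bimap (tens (join_str _)) f g) : cat_scope.
Notation "⊤" := (unit_ob (meet_str _)) : cat_scope.
Notation "⊥" := (unit_ob (join_str _)) : cat_scope.
Notation "'𝟏'" := (idc _) : cat_scope.

(* Prefix h is a hat (meet), prefix c is a check (join). *)
Notation hb_to := (b_to (meet_str _)).
Notation hb_from := (b_from (meet_str _)).
Notation cb_to := (b_to (join_str _)).
Notation cb_from := (b_from (join_str _)).
Notation hdelta_to := (delta_to (meet_str _)).
Notation hdelta_from := (delta_from (meet_str _)).
Notation cdelta_to := (delta_to (join_str _)).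
Notation cdelta_from := (delta_from (join_str _)).
Notation hsigma_to := (sigma_to (meet_str _)).
Notation hsigma_from := (sigma_from (meet_str _)).
Notation csigma_to := (sigma_to (join_str _)).
Notation csigma_from := (sigma_from (join_str _)).

Record intermuting (C : bimonoidal_category) := Intermuting {
  hw_from : (⊥ : C) ~> (⊥ ∧ ⊥);
  hw_to : (⊥ ∧ ⊥ : C) ~> ⊥;
  cw_to : (⊤ ∨ ⊤ : C) ~> ⊤;
  cw_from : (⊤ : C) ~> (⊤ ∨ ⊤);
  hw_fromK : hw_to ∘ hw_from = 𝟏;
  hw_toK : hw_from ∘ hw_to = 𝟏;
  cw_toK : cw_from ∘ cw_to = 𝟏;
  cw_fromK : cw_to ∘ cw_from = 𝟏;
  cw_assoc : cw_to ∘ (cw_to ∨₁ 𝟏) ∘ cb_to ⊤ ⊤ ⊤ = cw_to ∘ (𝟏 ∨₁ cw_to);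
  hw_coassoc :
    hb_from ⊥ ⊥ ⊥ ∘ (hw_from ∧₁ 𝟏) ∘ hw_from = (𝟏 ∧₁ hw_from) ∘ hw_from;

  kappa : (⊥ : C) ~> ⊤;
  kappa_cdelta : cdelta_to ⊤ = cw_to ∘ (𝟏 ∨₁ kappa);
  kappa_csigma : csigma_to ⊤ = cw_to ∘ (kappa ∨₁ 𝟏);
  kappa_hdelta : hdelta_from ⊥ = (𝟏 ∧₁ kappa) ∘ hw_from;
  kappa_hsigma : hsigma_from ⊥ = (kappa ∧₁ 𝟏) ∘ hw_from;

  ck : forall X Y Z T : C, ((X ∧ Y) ∨ (Z ∧ T)) ~> ((X ∨ Z) ∧ (Y ∨ T));
  ck_nat : forall (X X' Y Y' Z Z' T T' : C)
      (f : X ~> X') (g : Y ~> Y') (h : Z ~> Z') (k : T ~> T'),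
    ck X' Y' Z' T' ∘ ((f ∧₁ g) ∨₁ (h ∧₁ k))
    = ((f ∨₁ h) ∧₁ (g ∨₁ k)) ∘ ck X Y Z T;
  ck_cb : forall A1 A1' A2 A2' A3 A3' : C,
    ck (A1 ∨ A2) (A1' ∨ A2') A3 A3'
      ∘ (ck A1 A1' A2 A2' ∨₁ idc (A3 ∧ A3'))
      ∘ cb_to (A1 ∧ A1') (A2 ∧ A2') (A3 ∧ A3')
    = (cb_to A1 A2 A3 ∧₁ cb_to A1' A2' A3')
      ∘ ck A1 A1' (A2 ∨ A3) (A2' ∨ A3')
      ∘ (idc (A1 ∧ A1') ∨₁ ck A2 A2' A3 A3');
  ck_hb : forall A1 A1' A2 A2' A3 A3' : C,
    hb_from (A1 ∨ A1') (A2 ∨ A2') (A3 ∨ A3')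
      ∘ (ck A1 A2 A1' A2' ∧₁ idc (A3 ∨ A3'))
      ∘ ck (A1 ∧ A2) A3 (A1' ∧ A2') A3'
    = (idc (A1 ∨ A1') ∧₁ ck A2 A3 A2' A3')
      ∘ ck A1 (A2 ∧ A3) A1' (A2' ∧ A3')
      ∘ (hb_from A1 A2 A3 ∨₁ hb_from A1' A2' A3');
  ck_cdelta : forall A A' : C,
    cdelta_to (A ∧ A')
    = (cdelta_to A ∧₁ cdelta_to A') ∘ ck A A' ⊥ ⊥ ∘ (idc (A ∧ A') ∨₁ hw_from);
  ck_csigma : forall A A' : C,
    csigma_to (A ∧ A')
    = (csigma_to A ∧₁ csigma_to A') ∘ ck ⊥ ⊥ A A' ∘ (hw_from ∨₁ idc (A ∧ A'));
  ck_hdelta : forall A A' : C,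
    hdelta_from (A ∨ A')
    = (idc (A ∨ A') ∧₁ cw_to) ∘ ck A ⊤ A' ⊤ ∘ (hdelta_from A ∨₁ hdelta_from A');
  ck_hsigma : forall A A' : C,
    hsigma_from (A ∨ A')
    = (cw_to ∧₁ idc (A ∨ A')) ∘ ck ⊤ A ⊤ A' ∘ (hsigma_from A ∨₁ hsigma_from A');
  ck_kappa1 :
    hdelta_to ⊤ ∘ (cdelta_to ⊤ ∧₁ csigma_to ⊤) ∘ ck ⊤ ⊥ ⊥ ⊤
    = kappa ∘ cdelta_to ⊥ ∘ (hsigma_to ⊥ ∨₁ hdelta_to ⊥);
  ck_kappa2 :
    hdelta_to ⊤ ∘ (csigma_to ⊤ ∧₁ cdelta_to ⊤) ∘ ck ⊥ ⊤ ⊤ ⊥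
    = kappa ∘ cdelta_to ⊥ ∘ (hdelta_to ⊥ ∨₁ hsigma_to ⊥) }.

Record bimonoidal_intermuting_category := BimonoidalIntermuting {
  bim :> bimonoidal_category;
  bim_int :> intermuting bim }.

Record strict_monoidal (C : category) (M : monoidal C) : Prop := {
  strict_b_to : forall X Y Z, is_identity (b_to M X Y Z);
  strict_b_from : forall X Y Z, is_identity (b_from M X Y Z);
  strict_delta_to : forall X, is_identity (delta_to M X);
  strict_delta_from : forall X, is_identity (delta_from M X);
  strict_sigma_to : forall X, is_identity (sigma_to M X);
  strict_sigma_from : forall X, is_identity (sigma_from M X) }.

Definition strict (C : bimonoidal_intermuting_category) : Prop :=
  strict_monoidal (meet_str C) /\ strict_monoidal (join_str C).

Inductive canonical (C : bimonoidal_intermuting_category) :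
    forall A B : C, (A ~> B) -> Prop :=
| canonical_id A : canonical (idc A)
| canonical_hb_to X Y Z : canonical (hb_to X Y Z)
| canonical_hb_from X Y Z : canonical (hb_from X Y Z)
| canonical_cb_to X Y Z : canonical (cb_to X Y Z)
| canonical_cb_from X Y Z : canonical (cb_from X Y Z)
| canonical_hdelta_to X : canonical (hdelta_to X)
| canonical_hdelta_from X : canonical (hdelta_from X)
| canonical_hsigma_to X : canonical (hsigma_to X)
| canonical_hsigma_from X : canonical (hsigma_from X)
| canonical_cdelta_to X : canonical (cdelta_to X)
| canonical_cdelta_from X : canonical (cdelta_from X)
| canonical_csigma_to X : canonical (csigma_to X)
| canonical_csigma_from X : canonical (csigma_from X)
| canonical_hw_to : canonical (hw_to C)
| canonical_hw_from : canonical (hw_from C)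
| canonical_cw_to : canonical (cw_to C)
| canonical_cw_from : canonical (cw_from C)
| canonical_kappa : canonical (kappa C)
| canonical_ck X Y Z T : canonical (ck C X Y Z T)
| canonical_comp X Y Z (g : Y ~> Z) (f : X ~> Y) :
    canonical g -> canonical f -> canonical (g ∘ f)
| canonical_meet X X' Y Y' (f : X ~> X') (g : Y ~> Y') :
    canonical f -> canonical g -> canonical (f ∧₁ g)
| canonical_join X X' Y Y' (f : X ~> X') (g : Y ~> Y') :
    canonical f -> canonical g -> canonical (f ∨₁ g).

(* Iterated product of [A] along the list [r]. The product ends in the unit
   object, which strictness absorbs: A1 ξ (A2 ξ unit) = A1 ξ A2. *)
Definition big_ob (C : category) (M : monoidal C) (I : Type) (A : I -> C)
    (r : seq I) : C :=
  foldr (fun i X => tens M (A i, X)) (unit_ob M) r.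

Fixpoint big_hom (C : category) (M : monoidal C) (I : Type) (A B : I -> C)
    (f : forall i, A i ~> B i) (r : seq I) : big_ob M A r ~> big_ob M B r :=
  if r is i :: r' then bimap (tens M) (f i) (big_hom M f r')
  else idc (unit_ob M).

Lemma eq_big_hom (C : category) (M : monoidal C) (I : Type) (A B : I -> C)
    (f g : forall i, A i ~> B i) (r : seq I) :
  (forall i, f i = g i) -> big_hom M f r = big_hom M g r.
Proof. by move=> fg; elim: r => //= i r ->; rewrite fg. Qed.

Lemma big_hom_id (C : category) (M : monoidal C) (I : Type) (A : I -> C)
    (r : seq I) :
  big_hom M (fun i => idc (A i)) r = idc (big_ob M A r).
Proof. by elim: r => //= i r ->; apply: fmap_id. Qed.

Lemma big_hom_comp (C : category) (M : monoidal C) (I : Type) (X Y Z : I -> C)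
    (g : forall i, Y i ~> Z i) (f : forall i, X i ~> Y i) (r : seq I) :
  big_hom M (fun i => g i ∘ f i) r = big_hom M g r ∘ big_hom M f r.
Proof.
elim: r => [|i r IHr] /=; first by rewrite comp_idl.
by rewrite IHr /bimap -fmap_comp.
Qed.

(* For [alpha] an arrow m -> m' of the opposite category: the indices s with
   α(i-1) < s ≤ α(i), in increasing order. Indices are
   counted from 0 here: [s : 'I_m] and [i : 'I_m'] stand for s+1 and i+1, so
   that the condition reads α(i) ≤ s < α(i+1). *)
Definition block (m m' : nat) (alpha : simplex_hom m' m) (i : 'I_m') :
    seq 'I_m :=
  [seq s : 'I_m <- enum 'I_m |
     (alpha (widen_ord (leqnSn m') i) <= s < alpha (lift ord0 i))%N].

Definition Δop2 : category :=
  prod_category (op_category Δ) (op_category Δ).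

Definition bar_category (C : bimonoidal_intermuting_category)
    (p : Δop2) : category :=
  power_category ('I_p.1 * 'I_p.2)%type C.

Definition bar_ob (C : bimonoidal_intermuting_category) (p q : Δop2)
    (gamma : p ~> q) (A : bar_category C p) : bar_category C q := fun ij =>
  big_ob (meet_str C)
    (fun t => big_ob (join_str C) (fun s => A (s, t)) (block gamma.1 ij.1))
    (block gamma.2 ij.2).

Definition bar_hom (C : bimonoidal_intermuting_category) (p q : Δop2)
    (gamma : p ~> q) (A B : bar_category C p) (f : A ~> B) : bar_ob gamma A ~> bar_ob gamma B := fun ij =>
  big_hom (meet_str C)
    (fun t => big_hom (join_str C) (fun s => f (s, t)) (block gamma.1 ij.1))
    (block gamma.2 ij.2).

Definition bar_functor (C : bimonoidal_intermuting_category) (p q : Δop2)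
    (gamma : p ~> q) : functor (bar_category C p) (bar_category C q).
Proof.
refine (@Functor _ _ (bar_ob gamma) (@bar_hom C p q gamma) _ _).
- move=> A; apply: functional_extensionality_dep => ij.
  rewrite /bar_hom /= -big_hom_id; apply: eq_big_hom => t.
  exact: big_hom_id.
- move=> X Y Z g f; apply: functional_extensionality_dep => ij.
  rewrite /bar_hom /= -big_hom_comp; apply: eq_big_hom => t.
  exact: big_hom_comp.
Defined.

(* Main.v *)
Require Import Defs.
From mathcomp Require Import all_boot all_order.
From Stdlib Require Import FunctionalExtensionality ProofIrrelevance.

Set Implicit Arguments.
Unset Strict Implicit.
Unset Printing Implicit Defensive.

Import Order.Theory.

Local Open Scope cat_scope.

(** The block of a composite of simplicial maps is the concatenation of blocks,
so the structural transformation has to push every inner conjunction through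
the disjunction outside it, and then forget the bracketing. Pushing through is
done by an arrow ∨_S ∧_T X → ∧_T ∨_S X assembled from c^k, the arrows w and
kappa, the last two taking care of empty S and T. This arrow is built by
recursion on S, but the recursive equation on T also holds; hence it is
compatible with concatenation of both index lists, by the coherence equations
of c^k with the two associativities and the two units. Associativity of the lax
functor is these two compatibilities together with naturality, the rest being
identity arrows by strictness; its unit laws are the cases where S or T is a
singleton, where c^k meets only units. *)

(** * Arrows that are identities up to provable equality of their ends *)

Section IdentityArrows.

Variable C : category.

(** An arrow bundled with its ends can be transported along any equations for these ends. When the
    ends are already right, proof irrelevance turns the equations into [erefl] and the transports
    vanish. *)
Lemma arr_inj (A B : C) (f g : A ~> B) : f ≡ g -> f = g.
Proof.
move=> fg; pose P (a : arrow C) := forall (eA : dom a = A) (eB : cod a = B),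
  eq_rect _ (hom A) (eq_rect _ (fun X => X ~> cod a) (arr a) _ eA) _ eB = g.
suff: P (Arrow f) by move/(_ erefl erefl).
rewrite fg => eA eB.
by rewrite (proof_irrelevance _ eA erefl) (proof_irrelevance _ eB erefl).
Qed.

(** An elimination rule: it replaces the target by the source and the arrow by [idc A], so that no
    later argument handles transports. *)
Lemma is_identity_ind (A : C) (P : forall B, (A ~> B) -> Prop) :
  P A (idc A) -> forall B (f : A ~> B), is_identity f -> P B f.
Proof.
move=> PA B f idf; have eAB : A = B := esym (congr1 (@cod C) idf).
by case: B / eAB f idf => f /arr_inj ->.
Qed.

Lemma is_identity_cod (A B : C) (f : A ~> B) : is_identity f -> f ≡ idc B.
Proof. by move: B f; apply: is_identity_ind. Qed.

Lemma is_identity_uniq (A B : C) (f g : A ~> B) :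
  is_identity f -> is_identity g -> f = g.
Proof. by move=> idf idg; apply: arr_inj; rewrite idf idg. Qed.

Lemma is_identity_idc (A B X : C) (f : A ~> B) : f ≡ idc X -> is_identity f.
Proof.
move=> E; have eAX : A = X := congr1 (@dom C) E.
by rewrite /is_identity E eAX.
Qed.

Lemma arrow_idl (X Y Z : C) (g : Y ~> Z) (f : X ~> Y) :
  is_identity g -> g ∘ f ≡ f.
Proof. by move: Z g; apply: is_identity_ind; rewrite comp_idl. Qed.

Lemma arrow_idr (X Y Z : C) (g : Y ~> Z) (f : X ~> Y) :
  is_identity f -> g ∘ f ≡ g.
Proof. by move=> idf; move: Y f idf g; apply: is_identity_ind => g; rewrite comp_idr. Qed.

Lemma is_identity_comp (X Y Z : C) (g : Y ~> Z) (f : X ~> Y) :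
  is_identity g -> is_identity f -> is_identity (g ∘ f).
Proof. by move=> idg; rewrite /is_identity (arrow_idl f idg). Qed.

Lemma is_identity_cancel (X Y Z : C) (g : Y ~> Z) (f : X ~> Y) :
  is_identity g -> is_identity (g ∘ f) -> is_identity f.
Proof. by move=> idg; rewrite /is_identity (arrow_idl f idg). Qed.

Lemma is_identity_cancelr (X Y Z : C) (g : Y ~> Z) (f : X ~> Y) :
  is_identity f -> is_identity (g ∘ f) -> is_identity g.
Proof. by move=> idf idgf; apply: (@is_identity_idc _ _ X); rewrite -(arrow_idr g idf). Qed.

Lemma is_identity_bimap (T : functor (prod_category C C) C)
    (A A' B B' : C) (f : A ~> A') (g : B ~> B') :
  is_identity f -> is_identity g -> is_identity (bimap T f g).
Proof.
move=> idf idg; move: A' f idf B' g idg; apply: is_identity_ind.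
by apply: is_identity_ind; rewrite /is_identity /bimap (fmap_id T (A, B)).
Qed.

End IdentityArrows.

(** A family of bundled arrows determines its two families of ends, so function extensionality on
    the bundled family equates ends and components at once. *)
Lemma arrow_power (I : Type) (C : category) (A B A' B' : power_category I C)
    (f : A ~> B) (g : A' ~> B') :
  (forall i, f i ≡ g i) -> f ≡ g.
Proof.
move=> fg.
pose pack (a : I -> arrow C) := @Arrow (power_category I C)
  (fun i => dom (a i)) (fun i => cod (a i)) (fun i => arr (a i)).
rewrite -[Arrow f]/(pack (fun i => Arrow (f i))).
by rewrite (functional_extensionality _ _ fg).
Qed.

Lemma functor_ext (C D : category) (F G : functor C D) :
  (forall A, F A = G A) ->
  (forall A B (f : A ~> B), fmap F f ≡ fmap G f) -> F = G.
Proof.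
case: F G => [F0 F1 F2 F3] [G0 G1 G2 G3] /= /functional_extensionality e.
case: G0 / e G1 G2 G3 => G1 G2 G3 FG.
have e : F1 = G1.
  do 3![apply: functional_extensionality_dep => ?].
  exact/arr_inj/FG.
case: G1 / e G2 G3 {FG} => G2 G3.
by rewrite (proof_irrelevance _ F2 G2) (proof_irrelevance _ F3 G3).
Qed.

(** * Iterated products, their concatenation and their flattening *)

Section BigTensor.

Variables (C : category) (M : monoidal C).

Lemma bimap_comp (X Y Z X' Y' Z' : C) (f' : Y ~> Z) (f : X ~> Y)
    (g' : Y' ~> Z') (g : X' ~> Y') :
  bimap (tens M) f' g' ∘ bimap (tens M) f g = bimap (tens M) (f' ∘ f) (g' ∘ g).
Proof. by rewrite /bimap -fmap_comp. Qed.

Lemma bimap_id (X Y : C) : bimap (tens M) (idc X) (idc Y) = idc _.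
Proof. exact: (fmap_id (tens M) (X, Y)). Qed.

Lemma bimap_compr (X Y Z W : C) (g : Y ~> Z) (f : X ~> Y) :
  bimap (tens M) (idc W) (g ∘ f)
  = bimap (tens M) (idc W) g ∘ bimap (tens M) (idc W) f.
Proof. by rewrite bimap_comp comp_idl. Qed.

Lemma b_from_nat (X X' Y Y' Z Z' : C) (f : X ~> X') (g : Y ~> Y') (h : Z ~> Z') :
  b_from M X' Y' Z' ∘ bimap (tens M) (bimap (tens M) f g) h
  = bimap (tens M) f (bimap (tens M) g h) ∘ b_from M X Y Z.
Proof.
rewrite -[LHS]comp_idr -(b_fromK M X Y Z) comp_assoc -[X in X ∘ b_from _ _ _ _]comp_assoc.
by rewrite -b_nat comp_assoc b_toK comp_idl.
Qed.

(** Built from structural arrows, and not as a transport between equal objects, so that naturality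
    and canonicity follow by induction without strictness. *)
Fixpoint cat_hom (I : Type) (A : I -> C) (r1 r2 : seq I) :
    tens M (big_ob M A r1, big_ob M A r2) ~> big_ob M A (r1 ++ r2) :=
  if r1 is i :: r then
    bimap (tens M) (idc (A i)) (cat_hom A r r2)
      ∘ b_from M (A i) (big_ob M A r) (big_ob M A r2)
  else sigma_to M (big_ob M A r2).

Fixpoint flatten_hom (I K : Type) (A : I -> C) (T : K -> seq I) (r : seq K) :
    big_ob M (fun k => big_ob M A (T k)) r ~> big_ob M A (flatten (map T r)) :=
  if r is k :: r' then
    cat_hom A (T k) (flatten (map T r')) ∘ bimap (tens M) (idc _) (flatten_hom A T r')
  else idc (unit_ob M).

(* The target list is a parameter because the block of a composite is only
   provably equal to the concatenation of blocks. *)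
Definition flat_hom (I K : Type) (A : I -> C) (T : K -> seq I) (r : seq K)
    (r' : seq I) (e : flatten (map T r) = r') :
    big_ob M (fun k => big_ob M A (T k)) r ~> big_ob M A r' :=
  eq_rect _ (fun l => _ ~> big_ob M A l) (flatten_hom A T r) _ e.

Lemma cat_hom_nat (I : Type) (A B : I -> C) (f : forall i, A i ~> B i) r1 r2 :
  cat_hom B r1 r2 ∘ bimap (tens M) (big_hom M f r1) (big_hom M f r2)
  = big_hom M f (r1 ++ r2) ∘ cat_hom A r1 r2.
Proof.
elim: r1 => [|i r IH] /=; first by rewrite sigma_nat.
rewrite -comp_assoc b_from_nat comp_assoc bimap_comp IH comp_idl.
by rewrite comp_assoc bimap_comp comp_idr.
Qed.

Lemma flat_hom_nat (I K : Type) (A B : I -> C) (f : forall i, A i ~> B i)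
    (T : K -> seq I) r r' (e : flatten (map T r) = r') :
  flat_hom B e ∘ big_hom M (fun k => big_hom M f (T k)) r
  = big_hom M f r' ∘ flat_hom A e.
Proof.
case: r' / e => /=; elim: r => [|k r IH] //=.
rewrite -comp_assoc bimap_comp comp_idl IH comp_assoc -cat_hom_nat.
by rewrite -comp_assoc bimap_comp comp_idr.
Qed.

Hypothesis strictM : strict_monoidal M.

Lemma is_identity_big_hom (I : Type) (A B : I -> C) (f : forall i, A i ~> B i) r :
  (forall i, is_identity (f i)) -> is_identity (big_hom M f r).
Proof. by move=> idf; elim: r => //= i r IH; apply: is_identity_bimap. Qed.

Lemma is_identity_flat_hom (I K : Type) (A : I -> C) (T : K -> seq I) r r'
    (e : flatten (map T r) = r') :
  is_identity (flat_hom A e).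
Proof.
have idcat r1 r2 : is_identity (cat_hom A r1 r2).
  elim: r1 => [|i r1 IH] /=; first exact: strict_sigma_to strictM _.
  by apply/is_identity_comp/strict_b_from; [apply: is_identity_bimap | exact: strictM].
case: r' / e => /=; elim: r => [|k r IH] //=.
by apply: is_identity_comp => //; apply: is_identity_bimap.
Qed.

(** Under strictness both composites are identities with common ends, so no coherence computation is
    needed. *)
Lemma flat_hom_assoc (I K L : Type) (A : I -> C) (T1 : K -> seq I)
    (T2 : L -> seq K) (T3 : seq L) T12 T23 T123
    (e12 : forall l, flatten (map T1 (T2 l)) = T12 l)
    (e23 : flatten (map T2 T3) = T23)
    (e1 : flatten (map T1 T23) = T123) (e2 : flatten (map T12 T3) = T123) :
  flat_hom A e1 ∘ flat_hom (fun k => big_ob M A (T1 k)) e23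
  = flat_hom A e2 ∘ big_hom M (fun l => flat_hom A (e12 l)) T3.
Proof.
apply: is_identity_uniq; apply: is_identity_comp; try exact: is_identity_flat_hom.
by apply: is_identity_big_hom => l; apply: is_identity_flat_hom.
Qed.

(** The trailing unit is absorbed: [delta_to] is an identity, so its ends agree. *)
Lemma big_ob_seq1 (I : Type) (A : I -> C) i : big_ob M A [:: i] = A i.
Proof. exact: esym (congr1 (@cod C) (strict_delta_to strictM (A i))). Qed.

Lemma big_hom_seq1 (I : Type) (A B : I -> C) (f : forall i, A i ~> B i) i :
  big_hom M f [:: i] ≡ f i.
Proof.
rewrite -(arrow_idr (f i) (strict_delta_to strictM (A i))) -delta_nat.
by rewrite (arrow_idl _ (strict_delta_to strictM (B i))).
Qed.

End BigTensor.

(** * The arrow from joins of meets to meets of joins *)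

Section Intermutation.

Variable C : bimonoidal_intermuting_category.

Local Notation big_meet := (big_ob (meet_str C)).
Local Notation big_join := (big_ob (join_str C)).
Local Notation big_meet_hom := (big_hom (meet_str C)).
Local Notation big_join_hom := (big_hom (join_str C)).

(** The iterated comultiplication of the comonoid ⊥, whose counit is [kappa]. *)
Fixpoint bot_big_meet (K : Type) (T : seq K) : ⊥ ~> big_meet (fun _ => ⊥) T :=
  if T is t :: T' then (idc ⊥ ∧₁ bot_big_meet T') ∘ hw_from C else kappa C.

(** The case of two joinands. For empty [T] it is the multiplication of the monoid ⊤. *)
Fixpoint join_big_meet (K : Type) (P Q : K -> C) (T : seq K) :
    (big_meet P T ∨ big_meet Q T) ~> big_meet (fun t => P t ∨ Q t) T :=
  if T is t :: T' then
    (idc (P t ∨ Q t) ∧₁ join_big_meet P Q T')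
      ∘ ck C (P t) (big_meet P T') (Q t) (big_meet Q T')
  else cw_to C.

(** The dual case of two conjuncts, needed for recursion on the other index list. *)
Fixpoint big_join_meet (I : Type) (P Q : I -> C) (S : seq I) :
    big_join (fun s => P s ∧ Q s) S ~> (big_join P S ∧ big_join Q S) :=
  if S is s :: S' then
    ck C (P s) (Q s) (big_join P S') (big_join Q S')
      ∘ (idc (P s ∧ Q s) ∨₁ big_join_meet P Q S')
  else hw_from C.

Fixpoint intermute (I K : Type) (X : I -> K -> C) (S : seq I) (T : seq K) :
    big_join (fun s => big_meet (X s) T) S
    ~> big_meet (fun t => big_join (fun s => X s t) S) T :=
  if S is s :: S' then
    join_big_meet (X s) (fun t => big_join (fun s => X s t) S') T
      ∘ (idc (big_meet (X s) T) ∨₁ intermute X S' T)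
  else bot_big_meet T.

Lemma join_big_meet_nat (K : Type) (P Q P' Q' : K -> C)
    (f : forall t, P t ~> P' t) (g : forall t, Q t ~> Q' t) T :
  join_big_meet P' Q' T ∘ (big_meet_hom f T ∨₁ big_meet_hom g T)
  = big_meet_hom (fun t => f t ∨₁ g t) T ∘ join_big_meet P Q T.
Proof.
elim: T => [|t T IH] /=; first by rewrite bimap_id comp_idl comp_idr.
rewrite -comp_assoc ck_nat !comp_assoc !bimap_comp IH.
by rewrite comp_idl comp_idr.
Qed.

Lemma big_join_meet_nat (I : Type) (P Q P' Q' : I -> C)
    (f : forall s, P s ~> P' s) (g : forall s, Q s ~> Q' s) S :
  big_join_meet P' Q' S ∘ big_join_hom (fun s => f s ∧₁ g s) S
  = (big_join_hom f S ∧₁ big_join_hom g S) ∘ big_join_meet P Q S.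
Proof.
elim: S => [|s S IH] /=; first by rewrite bimap_id comp_idl comp_idr.
rewrite -comp_assoc bimap_comp IH comp_idl -[f s ∧₁ g s]comp_idr -bimap_comp.
by rewrite comp_assoc ck_nat -comp_assoc.
Qed.

Lemma intermute_nat (I K : Type) (X Y : I -> K -> C)
    (f : forall s t, X s t ~> Y s t) S T :
  intermute Y S T ∘ big_join_hom (fun s => big_meet_hom (f s) T) S
  = big_meet_hom (fun t => big_join_hom (fun s => f s t) S) T ∘ intermute X S T.
Proof.
elim: S => [|s S IH] /=; first by rewrite big_hom_id comp_idl comp_idr.
rewrite -comp_assoc bimap_comp IH comp_idl -[big_meet_hom (f s) T]comp_idr -bimap_comp.
by rewrite comp_assoc join_big_meet_nat -comp_assoc.
Qed.

(** The recursive equation on [T]. The case of empty [S] is the definition of [bot_big_meet]; the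
    inductive step slides the tail arrow past [ck] by naturality. *)
Lemma intermute_cons (I K : Type) (X : I -> K -> C) S t T :
  intermute X S (t :: T)
  = (𝟏 ∧₁ intermute X S T) ∘ big_join_meet (X^~ t) (fun s => big_meet (X s) T) S.
Proof.
elim: S => [|s S IH] //=.
rewrite IH -[X in X ∨₁ _](comp_idl (idc _)) -bimap_comp -[X in X ∨₁ (_ ∧₁ _)]bimap_id.
rewrite comp_assoc -(comp_assoc (_ ∧₁ _)) ck_nat comp_assoc bimap_comp bimap_id.
by rewrite comp_idl -comp_assoc.
Qed.

(** * Coherence of the binary cases with units and associativities *)

Lemma join_big_meet_csigma (K : Type) (Q : K -> C) T :
  big_meet_hom (fun t => csigma_to (Q t)) T
    ∘ (join_big_meet (fun _ => ⊥) Q T ∘ (bot_big_meet T ∨₁ 𝟏))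
  = csigma_to (big_meet Q T).
Proof.
(* The base case is the unit law of the monoid ⊤; each further conjunct contributes one instance of
   [ck_csigma]. *)
elim: T => [|t T IH] /=; first by rewrite comp_idl -kappa_csigma.
rewrite (ck_csigma C) -IH -[X in _ ∘ (_ ∨₁ X)](comp_idl (idc _)) -(bimap_comp _ _ (hw_from C)).
rewrite -[X in ((_ ∧₁ _) ∨₁ X)]bimap_id (comp_assoc _ (_ ∨₁ _)) -(comp_assoc _ (ck _ _ _ _ _)).
rewrite ck_nat !comp_assoc !bimap_comp bimap_id !comp_idr.
done.
Qed.

Lemma join_big_meet_cdelta (K : Type) (P : K -> C) T :
  big_meet_hom (fun t => cdelta_to (P t)) T
    ∘ (join_big_meet P (fun _ => ⊥) T ∘ (𝟏 ∨₁ bot_big_meet T))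
  = cdelta_to (big_meet P T).
Proof.
elim: T => [|t T IH] /=; first by rewrite comp_idl -kappa_cdelta.
rewrite (ck_cdelta C) -IH -[X in _ ∘ (X ∨₁ _)](comp_idl (idc _)) -(bimap_comp _ _ _ _ (hw_from C)).
rewrite -[X in (X ∨₁ (_ ∧₁ _))]bimap_id (comp_assoc _ (_ ∨₁ _)) -(comp_assoc _ (ck _ _ _ _ _)).
rewrite ck_nat !comp_assoc !bimap_comp bimap_id !comp_idr.
done.
Qed.

(** Induction on [T], from associativity of the monoid ⊤ through the coherence [ck_cb]. *)
Lemma join_big_meet_assoc (K : Type) (P Q R : K -> C) T :
  join_big_meet (fun t => P t ∨ Q t) R T ∘ (join_big_meet P Q T ∨₁ 𝟏) ∘ cb_to _ _ _
  = big_meet_hom (fun t => cb_to (P t) (Q t) (R t)) T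
    ∘ join_big_meet P (fun t => Q t ∨ R t) T ∘ (𝟏 ∨₁ join_big_meet Q R T).
Proof.
elim: T => [|t T IH] /=; first by rewrite cw_assoc comp_idl.
(* Splitting the tail arrows off lets naturality of [ck] carry them outward, leaving exactly the two
   instances of [ck] related by [ck_cb]. *)
have -> : (((𝟏 ∧₁ join_big_meet P Q T) ∘ ck C (P t) (big_meet P T) (Q t) (big_meet Q T))
    ∨₁ idc (R t ∧ big_meet R T))
  = ((𝟏 ∧₁ join_big_meet P Q T) ∨₁ (𝟏 ∧₁ 𝟏)) ∘ (ck C _ _ _ _ ∨₁ 𝟏).
  by rewrite bimap_comp bimap_id comp_idl.
have -> : (idc (P t ∧ big_meet P T)
    ∨₁ ((𝟏 ∧₁ join_big_meet Q R T) ∘ ck C (Q t) (big_meet Q T) (R t) (big_meet R T)))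
  = ((𝟏 ∧₁ 𝟏) ∨₁ (𝟏 ∧₁ join_big_meet Q R T)) ∘ (𝟏 ∨₁ ck C _ _ _ _).
  by rewrite bimap_comp bimap_id comp_idl.
rewrite !comp_assoc -(comp_assoc _ (ck _ _ _ _ _)) ck_nat.
rewrite -[in RHS](comp_assoc _ (ck _ _ _ _ _)) ck_nat.
rewrite !comp_assoc !bimap_comp !bimap_id !comp_idl !comp_idr.
rewrite -(comp_assoc _ (_ ∨₁ _)) -comp_assoc.
rewrite (comp_assoc (ck C _ _ _ _)) ck_cb !comp_assoc bimap_comp comp_idl.
by rewrite IH.
Qed.

(** The same square with its associativity isomorphisms inverted, the form required because
    [cat_hom] uses [b_from]. *)
Lemma join_big_meet_assoc_from (K : Type) (P Q R : K -> C) T :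
  join_big_meet P (fun t => Q t ∨ R t) T ∘ (𝟏 ∨₁ join_big_meet Q R T) ∘ cb_from _ _ _
  = big_meet_hom (fun t => cb_from (P t) (Q t) (R t)) T
    ∘ join_big_meet (fun t => P t ∨ Q t) R T ∘ (join_big_meet P Q T ∨₁ 𝟏).
Proof.
rewrite -[LHS]comp_idl -big_hom_id.
rewrite -(@eq_big_hom _ _ _ _ _ _ _ T (fun t => b_toK (join_str C) (P t) (Q t) (R t))).
rewrite big_hom_comp -!comp_assoc; congr (_ ∘ _).
rewrite !comp_assoc -join_big_meet_assoc -comp_assoc.
by rewrite b_fromK comp_idr.
Qed.

(** Dual induction on [S], from coassociativity of the comonoid ⊥ through the coherence [ck_hb]. *)
Lemma big_join_meet_coassoc (I : Type) (P Q R : I -> C) S :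
  (𝟏 ∧₁ big_join_meet Q R S) ∘ big_join_meet P (fun s => Q s ∧ R s) S
    ∘ big_join_hom (fun s => hb_from (P s) (Q s) (R s)) S
  = hb_from _ _ _ ∘ (big_join_meet P Q S ∧₁ 𝟏)
    ∘ big_join_meet (fun s => P s ∧ Q s) R S.
Proof.
elim: S => [|s S IH] /=; first by rewrite hw_coassoc comp_idr.
have -> : (idc (P s ∨ big_join P S)
    ∧₁ (ck C (Q s) (R s) (big_join Q S) (big_join R S) ∘ (𝟏 ∨₁ big_join_meet Q R S)))
  = (𝟏 ∧₁ ck C _ _ _ _) ∘ ((𝟏 ∨₁ 𝟏) ∧₁ (𝟏 ∨₁ big_join_meet Q R S)).
  by rewrite bimap_comp bimap_id comp_idl.
have -> : ((ck C (P s) (Q s) (big_join P S) (big_join Q S) ∘ (𝟏 ∨₁ big_join_meet P Q S))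
    ∧₁ idc (R s ∨ big_join R S))
  = (ck C _ _ _ _ ∧₁ 𝟏) ∘ ((𝟏 ∨₁ big_join_meet P Q S) ∧₁ (𝟏 ∨₁ 𝟏)).
  by rewrite bimap_comp bimap_id comp_idl.
rewrite !comp_assoc -(comp_assoc _ _ (ck _ _ _ _ _)) -ck_nat.
rewrite -[in RHS](comp_assoc _ _ (ck _ _ _ _ _)) -ck_nat.
rewrite -!comp_assoc !bimap_comp !bimap_id !comp_idl.
rewrite (comp_assoc (𝟏 ∧₁ big_join_meet Q R S)) IH.
rewrite -(comp_assoc (hb_from _ _ _)) -[X in X ∨₁ (hb_from _ _ _ ∘ _)]comp_idr -bimap_comp.
by rewrite !comp_assoc -ck_hb.
Qed.

(** Here [intermute X S [::]] is the iterated multiplication of ⊤ with unit [kappa]; it collects the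
    units that [hdelta_from] creates in each joinand. *)
Lemma big_join_meet_hdelta (I K : Type) (X : I -> K -> C) (P : I -> C) S :
  (𝟏 ∧₁ intermute X S [::]) ∘ big_join_meet P (fun _ => ⊤) S
    ∘ big_join_hom (fun s => hdelta_from (P s)) S
  = hdelta_from (big_join P S).
Proof.
elim: S => [|s S IH] /=; first by rewrite comp_idr -kappa_hdelta.
rewrite (ck_hdelta C) -IH .
rewrite -[X in X ∧₁ (cw_to C ∘ _)](comp_idl (idc _)) -bimap_comp.
rewrite -[X in X ∧₁ (𝟏 ∨₁ _)]bimap_id -!comp_assoc.
rewrite [in LHS](comp_assoc (_ ∧₁ _) (ck _ _ _ _ _)) -ck_nat.
by rewrite -!comp_assoc !bimap_comp !bimap_id !comp_idl.
Qed.

Lemma big_join_meet_hsigma (I K : Type) (X : I -> K -> C) (Q : I -> C) S :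
  (intermute X S [::] ∧₁ 𝟏) ∘ big_join_meet (fun _ => ⊤) Q S
    ∘ big_join_hom (fun s => hsigma_from (Q s)) S
  = hsigma_from (big_join Q S).
Proof.
elim: S => [|s S IH] /=; first by rewrite comp_idr -kappa_hsigma.
rewrite (ck_hsigma C) -IH.
rewrite -[X in (cw_to C ∘ _) ∧₁ X](comp_idl (idc _)) -bimap_comp.
rewrite -[X in (𝟏 ∨₁ _) ∧₁ X]bimap_id -!comp_assoc.
rewrite [in LHS](comp_assoc (_ ∧₁ _) (ck _ _ _ _ _)) -ck_nat.
by rewrite -!comp_assoc !bimap_comp !bimap_id !comp_idl.
Qed.

Lemma big_join_meet_hsigma_to (I K : Type) (X : I -> K -> C) (Q : I -> C) S :
  hsigma_to (big_join Q S) ∘ ((intermute X S [::] ∧₁ 𝟏) ∘ big_join_meet (fun _ => ⊤) Q S)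
  = big_join_hom (fun s => hsigma_to (Q s)) S.
Proof.
rewrite -[LHS]comp_idr -[X in _ ∘ X = _](big_hom_id (join_str C)).
rewrite -(@eq_big_hom _ _ _ _ _ _ _ S (fun s => sigma_toK (meet_str C) (Q s))).
rewrite big_hom_comp -comp_assoc (comp_assoc _ (big_join_hom _ _)) big_join_meet_hsigma.
by rewrite comp_assoc sigma_fromK comp_idl.
Qed.

(** * Compatibility with concatenation and flattening of either index list *)

Lemma intermute_cat_join (I K : Type) (X : I -> K -> C) S1 S2 T :
  intermute X (S1 ++ S2) T ∘ cat_hom (join_str C) (fun s => big_meet (X s) T) S1 S2
  = big_meet_hom (fun t => cat_hom (join_str C) (X^~ t) S1 S2) T
    ∘ (join_big_meet _ _ T ∘ (intermute X S1 T ∨₁ intermute X S2 T)).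
Proof.
elim: S1 => [|s S1 IH] /=.
  rewrite -(sigma_nat (join_str C)) -join_big_meet_csigma -!comp_assoc bimap_comp.
  by rewrite comp_idl comp_idr.
rewrite comp_assoc -(comp_assoc _ _ (_ ∨₁ cat_hom _ _ _ _)) bimap_comp comp_idl IH.
rewrite !bimap_compr.
rewrite -[X in (X ∨₁ big_meet_hom _ _) ∘ _](big_hom_id (meet_str C)).
rewrite !comp_assoc join_big_meet_nat big_hom_comp -!comp_assoc; congr (_ ∘ _).
(* What remains is to rebracket the head [s], the tail of [S1] and [S2]. *)
rewrite -b_from_nat !comp_assoc.
by rewrite join_big_meet_assoc_from -!comp_assoc bimap_comp comp_idl.
Qed.

(** Dual to the concatenation of joins: [intermute_cons] makes induction on [T1] possible, with the
    unit law for [hsigma_to] at the base and coassociativity in the step. *)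
Lemma intermute_cat_meet (I K : Type) (X : I -> K -> C) S T1 T2 :
  intermute X S (T1 ++ T2) ∘ big_join_hom (fun s => cat_hom (meet_str C) (X s) T1 T2) S
  = cat_hom (meet_str C) (fun t => big_join (X^~ t) S) T1 T2
    ∘ ((intermute X S T1 ∧₁ intermute X S T2) ∘ big_join_meet _ _ S).
Proof.
elim: T1 => [|t T1 IH].
  rewrite /= -(big_join_meet_hsigma_to X) !comp_assoc -(sigma_nat (meet_str C)).
  by rewrite -(comp_assoc _ (𝟏 ∧₁ _)) bimap_comp comp_idl comp_idr.
rewrite /= !intermute_cons.
rewrite big_hom_comp.
rewrite comp_assoc -(comp_assoc (𝟏 ∧₁ intermute _ _ _)) big_join_meet_nat big_hom_id.
rewrite comp_assoc bimap_comp IH comp_idl !bimap_compr -[intermute X S T2 in RHS]comp_idr.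
rewrite -(bimap_comp _ (𝟏 ∧₁ intermute X S T1)) -!comp_assoc; congr (_ ∘ _).
rewrite !comp_assoc b_from_nat -!comp_assoc; congr (_ ∘ _).
by rewrite !comp_assoc big_join_meet_coassoc.
Qed.

Lemma intermute_flat_join (I J K : Type) (X : I -> K -> C) (S1 : J -> seq I)
    S2 S (e : flatten (map S1 S2) = S) T :
  intermute X S T ∘ flat_hom (join_str C) (fun s => big_meet (X s) T) e
  = big_meet_hom (fun t => flat_hom (join_str C) (X^~ t) e) T
    ∘ intermute (fun j t => big_join (X^~ t) (S1 j)) S2 T
    ∘ big_join_hom (fun j => intermute X (S1 j) T) S2.
Proof.
case: S / e => /=; elim: S2 => [|j S2 IH] /=; first by rewrite big_hom_id comp_idl.
rewrite comp_assoc intermute_cat_join -!comp_assoc bimap_comp IH comp_idr big_hom_comp.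
rewrite -!comp_assoc; congr (_ ∘ _); rewrite bimap_comp comp_idl.
by rewrite [RHS]comp_assoc -join_big_meet_nat big_hom_id -comp_assoc bimap_comp comp_idl.
Qed.

Lemma intermute_flat_meet (I K L : Type) (X : I -> K -> C) (T1 : L -> seq K)
    T2 T (e : flatten (map T1 T2) = T) S :
  intermute X S T ∘ big_join_hom (fun s => flat_hom (meet_str C) (X s) e) S
  = flat_hom (meet_str C) (fun t => big_join (X^~ t) S) e
    ∘ big_meet_hom (fun l => intermute X S (T1 l)) T2
    ∘ intermute (fun s l => big_meet (X s) (T1 l)) S T2.
Proof.
case: T / e => /=; elim: T2 => [|l T2 IH] /=.
  rewrite (big_hom_id (join_str C)) !comp_idl comp_idr.
  (* Over an empty [T] the arrow does not depend on the family, but this requires unfolding along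
     [S]. *)
  by elim: S => //= s S ->.
rewrite big_hom_comp comp_assoc intermute_cat_meet -!comp_assoc; congr (_ ∘ _).
rewrite big_join_meet_nat big_hom_id comp_assoc bimap_comp IH comp_idr.
by rewrite intermute_cons !comp_assoc !bimap_comp !comp_idl comp_idr.
Qed.

(** * Canonicity, and the components of the structural transformation *)

Lemma canonical_big_meet_hom (I : Type) (A B : I -> C) (f : forall i, A i ~> B i) r :
  (forall i, canonical (f i)) -> canonical (big_meet_hom f r).
Proof.
by move=> canf; elim: r => [|i r IH] /=; [apply: canonical_id | apply: canonical_meet].
Qed.

Lemma canonical_flat_meet (I K : Type) (A : I -> C) (T : K -> seq I) r r'
    (e : flatten (map T r) = r') :
  canonical (flat_hom (meet_str C) A e).
Proof.
case: r' / e => /=; elim: r => [|k r IH] /=; first exact: canonical_id.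
apply: canonical_comp; last by apply: canonical_meet => //; apply: canonical_id.
elim: (T k) => [|i l IHl] /=; first exact: canonical_hsigma_to.
apply: canonical_comp; last exact: canonical_hb_from.
by apply: canonical_meet => //; apply: canonical_id.
Qed.

Lemma canonical_flat_join (I K : Type) (A : I -> C) (T : K -> seq I) r r'
    (e : flatten (map T r) = r') :
  canonical (flat_hom (join_str C) A e).
Proof.
case: r' / e => /=; elim: r => [|k r IH] /=; first exact: canonical_id.
apply: canonical_comp; last by apply: canonical_join => //; apply: canonical_id.
elim: (T k) => [|i l IHl] /=; first exact: canonical_csigma_to.
apply: canonical_comp; last exact: canonical_cb_from.
by apply: canonical_join => //; apply: canonical_id.
Qed.

Lemma canonical_intermute (I K : Type) (X : I -> K -> C) S T :
  canonical (intermute X S T).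
Proof.
elim: S => [|s S IH] /=.
  elim: T => [|t T IH] /=; first exact: canonical_kappa.
  apply: canonical_comp (canonical_hw_from C).
  by apply: canonical_meet => //; apply: canonical_id.
apply: canonical_comp; last by apply: canonical_join => //; apply: canonical_id.
elim: T {IH} => [|t T IH] /=; first exact: canonical_cw_to.
apply: canonical_comp (canonical_ck _ _ _ _).
by apply: canonical_meet => //; apply: canonical_id.
Qed.

(** In each outer conjunct the inner meets are moved out of the join and the nested joins are
    merged; last, the nested meets are merged. *)
Definition interchange (I1 I2 K1 K2 : Type) (A : I1 -> K1 -> C)
    (S1 : I2 -> seq I1) (T1 : K2 -> seq K1) (S2 : seq I2) (T2 : seq K2)
    (S : seq I1) (T : seq K1) (eS : flatten (map S1 S2) = S)
    (eT : flatten (map T1 T2) = T) :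
    big_meet (fun k => big_join (fun i =>
      big_meet (fun t => big_join (A^~ t) (S1 i)) (T1 k)) S2) T2
    ~> big_meet (fun t => big_join (A^~ t) S) T :=
  flat_hom (meet_str C) (fun t => big_join (A^~ t) S) eT
    ∘ big_meet_hom (fun k =>
        big_meet_hom (fun t => flat_hom (join_str C) (A^~ t) eS) (T1 k)
          ∘ intermute (fun i t => big_join (A^~ t) (S1 i)) S2 (T1 k)) T2.

Lemma canonical_interchange (I1 I2 K1 K2 : Type) (A : I1 -> K1 -> C)
    (S1 : I2 -> seq I1) (T1 : K2 -> seq K1) S2 T2 S T
    (eS : flatten (map S1 S2) = S) (eT : flatten (map T1 T2) = T) :
  canonical (interchange A eS eT).
Proof.
apply: canonical_comp (canonical_flat_meet _ _) _.
apply: canonical_big_meet_hom => k.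
apply: canonical_comp (canonical_intermute _ _ _).
by apply: canonical_big_meet_hom => t; apply: canonical_flat_join.
Qed.

Lemma interchange_nat (I1 I2 K1 K2 : Type) (A B : I1 -> K1 -> C)
    (f : forall s t, A s t ~> B s t)
    (S1 : I2 -> seq I1) (T1 : K2 -> seq K1) S2 T2 S T
    (eS : flatten (map S1 S2) = S) (eT : flatten (map T1 T2) = T) :
  interchange B eS eT
    ∘ big_meet_hom (fun k => big_join_hom (fun i =>
        big_meet_hom (fun t => big_join_hom (f^~ t) (S1 i)) (T1 k)) S2) T2
  = big_meet_hom (fun t => big_join_hom (f^~ t) S) T ∘ interchange A eS eT.
Proof.
rewrite /interchange comp_assoc -flat_hom_nat -!comp_assoc -!big_hom_comp.
congr (_ ∘ _); apply: eq_big_hom => k.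
rewrite -comp_assoc intermute_nat !comp_assoc -!big_hom_comp; congr (_ ∘ _).
by apply: eq_big_hom => t; rewrite flat_hom_nat.
Qed.

(** * Unit and associativity laws under strictness *)

Hypothesis strictC : strict C.

(** A singleton join ends in ⊥, so following the arrow by right unit arrows gives [cdelta_to] of the
    meet. By strictness these are all identities, and they cancel. *)
Lemma is_identity_intermute_seq1l (I K : Type) (X : I -> K -> C) s T :
  is_identity (intermute X [:: s] T).
Proof.
have [_ strictJ] := strictC.
apply: (@is_identity_cancel _ _ _ _ (big_meet_hom (fun t => cdelta_to (X s t)) T)).
  by apply: is_identity_big_hom => t; apply: strict_delta_to strictJ _.
by rewrite join_big_meet_cdelta; apply: strict_delta_to strictJ _.
Qed.

Lemma is_identity_intermute_seq1r (I K : Type) (X : I -> K -> C) S t :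
  is_identity (intermute X S [:: t]).
Proof.
have [strictM _] := strictC; rewrite intermute_cons.
apply: (@is_identity_cancelr _ _ _ _ _ (big_join_hom (fun s => hdelta_from (X s t)) S)).
  by apply: is_identity_big_hom => s; apply: strict_delta_from strictM _.
by rewrite big_join_meet_hdelta; apply: strict_delta_from strictM _.
Qed.

Lemma is_identity_interchange (I1 I2 K1 K2 : Type) (A : I1 -> K1 -> C)
    (S1 : I2 -> seq I1) (T1 : K2 -> seq K1) S2 T2 S T
    (eS : flatten (map S1 S2) = S) (eT : flatten (map T1 T2) = T) :
  (forall k, is_identity (intermute (fun i t => big_join (A^~ t) (S1 i)) S2 (T1 k))) ->
  is_identity (interchange A eS eT).
Proof.
have [strictM strictJ] := strictC => idA.
apply: is_identity_comp; first exact: is_identity_flat_hom.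
apply: is_identity_big_hom => k; apply: is_identity_comp => //.
by apply: is_identity_big_hom => t; apply: is_identity_flat_hom.
Qed.

Lemma interchange_assoc (I1 I2 I3 K1 K2 K3 : Type) (A : I1 -> K1 -> C)
    (S1 : I2 -> seq I1) (S2 : I3 -> seq I2) (S3 : seq I3)
    (T1 : K2 -> seq K1) (T2 : K3 -> seq K2) (T3 : seq K3)
    S12 S23 S T12 T23 T
    (eS12 : forall i, flatten (map S1 (S2 i)) = S12 i)
    (eS23 : flatten (map S2 S3) = S23)
    (eSl : flatten (map S1 S23) = S) (eSr : flatten (map S12 S3) = S)
    (eT12 : forall k, flatten (map T1 (T2 k)) = T12 k)
    (eT23 : flatten (map T2 T3) = T23)
    (eTl : flatten (map T1 T23) = T) (eTr : flatten (map T12 T3) = T) :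
  interchange A eSr eTr
    ∘ big_meet_hom (fun k => big_join_hom (fun i =>
        interchange A (eS12 i) (eT12 k)) S3) T3
  = interchange A eSl eTl
    ∘ interchange (fun i k => big_meet (fun t => big_join (A^~ t) (S1 i)) (T1 k))
        eS23 eT23.
Proof.
have [strictM strictJ] := strictC.
rewrite /interchange.
(* Both flattenings of meets are brought to the far left, where they agree up to associativity; the
   claim then reduces to one [k] of [T3]. *)
rewrite [RHS]comp_assoc -[in RHS](comp_assoc (flat_hom _ _ eTl)) -flat_hom_nat.
rewrite [in RHS]comp_assoc (flat_hom_assoc strictM _ eT12 eT23 eTl eTr).
rewrite -!comp_assoc -!big_hom_comp; congr (_ ∘ _); apply: eq_big_hom => k.
rewrite (big_hom_comp (join_str C)) comp_assoc -(comp_assoc (big_meet_hom _ _) (intermute _ _ _)).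
(* On the left the outer intermutation passes the inner flattening of meets, which reduces the claim
   to one [l] of [T2 k]. *)
rewrite intermute_flat_meet !comp_assoc -flat_hom_nat -!comp_assoc; congr (_ ∘ _).
rewrite intermute_nat !comp_assoc -!big_hom_comp; congr (_ ∘ _).
apply: eq_big_hom => l.
(* Dually, on the right the intermutation passes the flattening of joins. *)
rewrite -[RHS]comp_assoc intermute_flat_join !comp_assoc -!big_hom_comp.
rewrite (@eq_big_hom _ _ _ _ _ _ _ _ (fun t => flat_hom_assoc strictJ (A^~ t) eS12 eS23 eSl eSr)).
rewrite !big_hom_comp -!comp_assoc; congr (_ ∘ _).
by rewrite !comp_assoc -intermute_nat.
Qed.

End Intermutation.

(** * Blocks of simplicial maps as intervals of naturals *)

Lemma filter_iota_interval a b m :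
  b <= m -> [seq i <- iota 0 m | a <= i < b] = iota a (b - a).
Proof.
move=> le_bm; apply: (irr_sorted_eq ltn_trans ltnn) => [||i].
- exact/(sorted_filter ltn_trans)/iota_ltn_sorted.
- exact: iota_ltn_sorted.
- rewrite mem_filter !mem_iota /= add0n -andbA; case: (leqP a i) => //= le_ai.
  have [le_ab|lt_ba] := leqP a b.
    by rewrite subnKC //; case: ltnP => //= lt_ib; apply: leq_trans le_bm.
  (* For b < a the truncated difference is 0 and both lists are empty. *)
  rewrite (eqP (ltnW lt_ba : b - a == 0)) addn0 [RHS]ltnNge le_ai ltnNge.
  by rewrite (ltnW (leq_trans lt_ba le_ai)).
Qed.

(* Junk for [k > m']: [inord] then returns 0. *)
Definition simplex_nat (m m' : nat) (alpha : simplex_hom m' m) (k : nat) : nat :=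
  alpha (inord k).

Lemma simplex_nat_le m m' (alpha : simplex_hom m' m) k l :
  k <= l <= m' -> simplex_nat alpha k <= simplex_nat alpha l.
Proof.
case/andP=> le_kl le_lm.
have : (inord k <= inord l :> 'I_m'.+1)%O by rewrite leEord /= !inordK ?ltnS // (leq_trans le_kl).
by move/(omorph_le alpha); rewrite leEord.
Qed.

Lemma val_block m m' (alpha : simplex_hom m' m) (i : 'I_m') :
  map val (block alpha i)
  = iota (simplex_nat alpha i) (simplex_nat alpha i.+1 - simplex_nat alpha i).
Proof.
have -> : simplex_nat alpha i = alpha (widen_ord (leqnSn m') i).
  by rewrite /simplex_nat; congr (val (alpha _)); apply: val_inj; rewrite /= inordK // ltnS ltnW.
have -> : simplex_nat alpha i.+1 = alpha (lift ord0 i).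
  by rewrite /simplex_nat; congr (val (alpha _)); apply: val_inj; rewrite /= inordK // ltnS.
by rewrite -(@filter_iota_interval _ _ m) -1?ltnS // -val_enum_ord filter_map.
Qed.

Lemma block_id p (i : 'I_p) : block (idc (p : Δ)) i = [:: i].
Proof.
apply: (inj_map val_inj); rewrite val_block /simplex_nat /= !inordK ?ltnS //; last exact: ltnW.
by rewrite subSnn.
Qed.

(** Successive blocks of [f] are adjacent intervals, so their concatenation telescopes; monotonicity
    keeps the subtractions from truncating. *)
Lemma block_comp p q r (f : simplex_hom q p) (g : simplex_hom r q) (i : 'I_r) :
  flatten (map (block f) (block g i)) = block (simplex_comp f g) i.
Proof.
have natE k : simplex_nat (simplex_comp f g) k = simplex_nat f (simplex_nat g k).
  by rewrite /simplex_nat /= inord_val.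
apply: (inj_map val_inj); rewrite val_block !natE map_flatten -map_comp.
rewrite (eq_map (val_block f)).
rewrite (map_comp (fun k => iota (simplex_nat f k) (simplex_nat f k.+1 - simplex_nat f k)) val).
rewrite val_block.
have le_g : simplex_nat g i <= simplex_nat g i.+1 by apply: simplex_nat_le; rewrite leqnSn /=.
have le_gq : simplex_nat g i.+1 <= q by rewrite -ltnS; apply: ltn_ord.
move: (simplex_nat g i) (simplex_nat g i.+1) le_g le_gq => a b le_ab.
(* The right end becomes a + n, for induction on the number n of adjacent blocks. *)
rewrite -{1 3}(subnKC le_ab); move: (b - a) => n {b le_ab}.
elim: n a => [|n IH] a /=; first by rewrite addn0 subnn.
rewrite -addSnnS => le_nq; rewrite IH //.
have le_a : simplex_nat f a <= simplex_nat f a.+1.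
  by apply: simplex_nat_le; rewrite leqnSn (leq_trans _ le_nq) ?leq_addr.
have le_n : simplex_nat f a.+1 <= simplex_nat f (a.+1 + n).
  by apply: simplex_nat_le; rewrite leq_addr.
rewrite -{2}(subnKC le_a) -iotaD.
by rewrite addnC addnBA // subnK.
Qed.

(** * Assembly of the lax functor *)

Theorem mainTheorem4 (C : bimonoidal_intermuting_category)
    (strictC : strict C) :
  exists L : @lax_functor_on Δop2 (bar_category C) (@bar_functor C),
    forall (p q r : Δop2) (f : p ~> q) (g : q ~> r) (A : bar_category C p)
      (ij : 'I_r.1 * 'I_r.2),
      canonical (@lax_comp _ _ _ L p q r f g A ij).
Proof.
have [strictM strictJ] := strictC.
pose phi (p q r : Δop2) (f : p ~> q) (g : q ~> r) (A : bar_category C p) :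
    bar_functor C g (bar_functor C f A) ~> bar_functor C (g ∘ f) A :=
  fun ij => interchange (fun s t => A (s, t))
    (block_comp f.1 g.1 ij.1) (block_comp f.2 g.2 ij.2).
have phi_nat p q r f g (A B : bar_category C p) (h : A ~> B) :
    phi p q r f g B ∘ fmap (comp_functor (bar_functor C g) (bar_functor C f)) h
    = fmap (bar_functor C (g ∘ f)) h ∘ phi p q r f g A.
  by apply: functional_extensionality_dep => ij; apply: interchange_nat.
unshelve eexists.
- refine (@LaxFunctorOn Δop2 (bar_category C) (@bar_functor C) _
    (fun p q r f g => NatTrans (@phi_nat p q r f g)) _ _ _).
  + move=> p; apply: functor_ext => [A | A B f].
      apply: functional_extensionality_dep => -[i j].
      by rewrite /= /bar_ob /= !block_id !big_ob_seq1.
    apply: arrow_power => -[i j].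
    rewrite /= /bar_hom /bar_ob /= !block_id big_hom_seq1 //.
    by rewrite big_hom_seq1.
  (* An identity as the second map makes the outer list of joins a singleton; as the first map, in
     the next case, it makes each inner list of meets one. *)
  + move=> p q f A; apply: arrow_power => ij; apply: is_identity_cod.
    apply: is_identity_interchange => // k.
    by rewrite /= block_id; apply: is_identity_intermute_seq1l.
  + move=> p q f A; apply: arrow_power => ij; apply: is_identity_cod.
    apply: is_identity_interchange => // k.
    by rewrite /= block_id; apply: is_identity_intermute_seq1r.
  + move=> p q r s f g h A; apply: arrow_power => ij.
    (* The ends are convertible: a block reads only the values of its map, and composition of
       functions associates by computation. *)
    rewrite /phi /= /bar_hom /=; congr (Arrow _).
    exact: (interchange_assoc strictC (fun s t => A (s, t))
      (block_comp f.1 g.1) (block_comp g.1 h.1 ij.1)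
      (block_comp f.1 (simplex_comp g.1 h.1) ij.1)
      (block_comp (simplex_comp f.1 g.1) h.1 ij.1)
      (block_comp f.2 g.2) (block_comp g.2 h.2 ij.2)
      (block_comp f.2 (simplex_comp g.2 h.2) ij.2)
      (block_comp (simplex_comp f.2 g.2) h.2 ij.2)).
- by move=> p q r f g A ij; apply: canonical_interchange.
Qed.
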